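(* Let $n>p\ge 1$ be integers, let $A\in\mathbb{R}^{n\times n}$ be symmetric with eigendecomposition $A=V\Lambda V^\top$, where $V=(v_1,\dots,v_n)\in\mathbb{R}^{n\times n}$ is orthogonal and $\Lambda=\mathrm{diag}(\lambda_1,\dots,\lambda_n)$ with $\lambda_1<\lambda_2<\cdots<\lambda_p<\lambda_{p+1}\le\cdots\le\lambda_n$. Let $\mu>0$ and let $W=\mathrm{diag}(w_1,\dots,w_p)$ be a real diagonal matrix with $w_1>w_2>\cdots>w_p>\lambda_p/\mu$. Then any global minimizer $X^*$ over $\mathbb{R}^{n\times p}$ of $$f_{\mu,W}(X)=\tfrac12\mathrm{tr}(X^\top AX)+\tfrac{\mu}{4}\|X^\top X-W\|_{\mathrm F}^2$$ has the form $X^*=V_pS_p$, where $V_p=(v_1,v_2,\dots,v_p)$ and $S_p=\mathrm{diag}(\pm s_1,\pm s_2,\dots,\pm s_p)$ (for some choice of signs) with $$s_i=\sqrt{w_i-\frac{\lambda_i}{\mu}},\qquad i=1,\dots,p.$$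
   Context: $\|\cdot\|_{\mathrm F}$ is the Frobenius norm. *)

(* Defs.v *)
From HB Require Import structures.
From mathcomp Require Import all_boot all_order all_algebra.
From mathcomp Require Import reals.
Set Implicit Arguments.
Unset Strict Implicit.
Unset Printing Implicit Defensive.
Import Order.TTheory GRing.Theory Num.Theory.
Local Open Scope ring_scope.

Definition frobenius_norm (R : realType) (m n : nat) (B : 'M[R]_(m, n)) : R :=
  Num.sqrt (\sum_(i < m) \sum_(j < n) B i j ^+ 2).

Definition orthogonal_mx (R : realType) (n : nat) (V : 'M[R]_n) : Prop :=
  V^T *m V = 1%:M.

Definition leading_cols (R : realType) (n p : nat) (hpn : (p <= n)%N)
    (V : 'M[R]_n) : 'M[R]_(n, p) :=
  colsub (widen_ord hpn) V.

Definition penalty_fun (R : realType) (n p : nat) (A : 'M[R]_n) (mu : R)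
    (W : 'M[R]_p) (X : 'M[R]_(n, p)) : R :=
  1 / 2 * \tr (X^T *m A *m X) + mu / 4 * frobenius_norm (X^T *m X - W) ^+ 2.

Definition global_minimizer (R : realType) (T : Type) (f : T -> R) (x : T) :
    Prop :=
  forall y : T, f x <= f y.

(* Main.v *)
Require Import Defs.
From HB Require Import structures.
From mathcomp Require Import all_boot all_order all_algebra.
From mathcomp Require Import reals.
From mathcomp Require Import ring lra.
Set Implicit Arguments.
Unset Strict Implicit.
Unset Printing Implicit Defensive.
Import Order.TTheory GRing.Theory Num.Theory.
Local Open Scope ring_scope.

(** Put [Y = V^T X], [a = lam / mu] and [G = Y^T Y].  Since [V] is orthogonal, the
    penalty equals, up to the factor [mu] and an additive constant,
    [h(Y) = 1/2 tr (Y^T diag(a) Y) - 1/2 tr (G W) + 1/4 tr (G^2)],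
    so the claim is that a minimizer [Y] of [h] is supported on the entries
    [(j, j)], where [Y_jj ^ 2 = w_j - a_j].

    Stationarity reads [diag(a) Y - Y W + Y G = 0].  Multiplied by [Y^T] it makes
    [G W] symmetric, hence [G] commutes with [W]; as the [w_j] are distinct, [G] is
    diagonal ([critical_gram_diag]).  Stationarity then says that each column of
    [Y] is either zero or an eigenvector of [diag(a)] with eigenvalue
    [w_j - G_jj] ([critical_entry]), and with orthogonal columns [h] is a sum of
    one cost per column.

    It remains to see that column [j] goes with the eigenvalue [a_j].  That
    eigenvalue is simple, so it suffices that [Y_jj <> 0]; this is shown by
    strong induction on [j] ([minimizer_diag_neq0]).  The earlier columns occupy
    the directions before [j], so if [Y_jj = 0] then column [j] is zero or carries
    an eigenvalue larger than [a_j], and [G_jj < w_j - a_j].  If no column uses the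
    direction [e_j], replacing column [j] by the best multiple of [e_j] lowers [h].
    If some column [k] does, then [k > j], and giving [e_j] to column [j] and a
    suitable multiple of the old column [j] to column [k] lowers [h], because
    larger weights should meet smaller eigenvalues ([exists_swap_gain] is this
    rearrangement inequality). *)

(** * Gram matrices and traces *)

Lemma mxtrace_trmul (R : comPzRingType) (m n : nat) (B C : 'M[R]_(m, n)) :
  \tr (B^T *m C) = \sum_i \sum_j B i j * C i j.
Proof.
rewrite /mxtrace exchange_big /=; apply: eq_bigr => j _.
by rewrite mxE; apply: eq_bigr => i _; rewrite mxE.
Qed.

Lemma gramE (R : pzSemiRingType) (n p : nat) (Y : 'M[R]_(n, p)) j k :
  (Y^T *m Y) j k = \sum_i Y i j * Y i k.
Proof. by rewrite mxE; apply: eq_bigr => i _; rewrite mxE. Qed.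

Lemma gram_ge0 (R : realDomainType) (n p : nat) (Y : 'M[R]_(n, p)) j :
  0 <= (Y^T *m Y) j j.
Proof. by rewrite gramE sumr_ge0 // => i _; rewrite -expr2 sqr_ge0. Qed.

Lemma gram_gt0 (R : realDomainType) (n p : nat) (Y : 'M[R]_(n, p)) i j :
  Y i j != 0 -> 0 < (Y^T *m Y) j j.
Proof.
move=> Yij; rewrite gramE (bigD1 i) //= ltr_pwDl //.
  by rewrite -expr2 exprn_even_gt0.
by rewrite sumr_ge0 // => l _; rewrite -expr2 sqr_ge0.
Qed.

Lemma mxtrace_gram_eq0 (R : realDomainType) (n p : nat) (Y : 'M[R]_(n, p)) :
  \tr (Y^T *m Y) = 0 -> Y = 0.
Proof.
move=> /eqP; rewrite psumr_eq0 => [/allP G0|j _]; last exact: gram_ge0.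
apply/matrixP => i j; rewrite mxE; apply/eqP/negPn/negP => /gram_gt0.
by have /eqP -> := G0 j (mem_index_enum j); rewrite ltxx.
Qed.

(** * Diagonalized form of the penalty *)

(** The penalty in the eigenbasis of [A], divided by [mu] and without the constant
    [1/4 tr (W^2)]. Written with traces rather than entries, since both the
    stationarity equation and the comparison with the penalty are identities
    between traces. *)
Definition reduced_cost (R : rcfType) (n p : nat) (a : 'rV[R]_n) (w : 'rV[R]_p)
    (Y : 'M[R]_(n, p)) : R :=
  1 / 2 * \tr (Y^T *m diag_mx a *m Y) - 1 / 2 * \tr (Y^T *m Y *m diag_mx w)
  + 1 / 4 * \tr (Y^T *m Y *m (Y^T *m Y)).

Lemma frobenius_normE (R : realType) (m n : nat) (B : 'M[R]_(m, n)) :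
  frobenius_norm B ^+ 2 = \tr (B^T *m B).
Proof.
rewrite /frobenius_norm sqr_sqrtr; last first.
  by apply: sumr_ge0 => i _; apply: sumr_ge0 => j _; exact: sqr_ge0.
by rewrite mxtrace_trmul.
Qed.

Lemma penalty_reduced (R : realType) (n p : nat) (V : 'M[R]_n) (lam : 'rV[R]_n)
    (mu : R) (w : 'rV[R]_p) (Y : 'M[R]_(n, p)) :
  orthogonal_mx V -> mu != 0 ->
  penalty_fun (V *m diag_mx lam *m V^T) mu (diag_mx w) (V *m Y) =
  mu * reduced_cost (mu^-1 *: lam) w Y + mu / 4 * \tr (diag_mx w *m diag_mx w).
Proof.
move=> hV mu0; rewrite /penalty_fun /reduced_cost frobenius_normE.
have VY m (B : 'M_(n, m)) : V^T *m (V *m B) = B by rewrite mulmxA hV mul1mx.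
have -> : (V *m Y)^T *m (V *m diag_mx lam *m V^T) *m (V *m Y) =
    Y^T *m diag_mx lam *m Y by rewrite trmx_mul -!mulmxA !VY.
have -> : (V *m Y)^T *m (V *m Y) = Y^T *m Y by rewrite trmx_mul -!mulmxA VY.
have -> : diag_mx (mu^-1 *: lam) = mu^-1 *: diag_mx lam by rewrite linearZ.
rewrite -scalemxAr -scalemxAl linearZ /=.
have -> : (Y^T *m Y - diag_mx w)^T = Y^T *m Y - diag_mx w.
  by rewrite linearB /= tr_diag_mx trmx_mul trmxK.
rewrite mulmxBl !mulmxBr !linearB /=.
rewrite [\tr (diag_mx w *m (Y^T *m Y))]mxtrace_mulC.
by field.
Qed.

(** * Stationarity *)

(** This stands in for differentiation: [h] along a line is a quartic polynomial.
    Evaluating at [t = - c1 s] with [0 < s <= 1] and dividing by [s] gives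
    [c1^2 <= s K], where [K] bounds the contribution of the higher coefficients. *)
Lemma quartic_ge0_linear_eq0 (R : realFieldType) (c1 c2 c3 c4 : R) :
  (forall t, 0 <= c1 * t + c2 * t ^+ 2 + c3 * t ^+ 3 + c4 * t ^+ 4) -> c1 = 0.
Proof.
move=> h; apply/eqP/negPn/negP => c10.
set K := `|c2 * c1 ^+ 2| + `|c3 * c1 ^+ 3| + `|c4 * c1 ^+ 4|.
have K0 : 0 <= K by rewrite !addr_ge0.
have c1p : 0 < c1 ^+ 2 by rewrite exprn_even_gt0.
have dp : 0 < c1 ^+ 2 + K + 1 by lra.
(* Any s in ]0, 1] with s * K < c1 ^+ 2 would do; this one needs no case split. *)
set s := c1 ^+ 2 / (c1 ^+ 2 + K + 1).
have s0 : 0 < s by rewrite divr_gt0.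
have s1 : s <= 1 by rewrite ler_pdivrMr //; lra.
have sE : s * (c1 ^+ 2 + K + 1) = c1 ^+ 2 by rewrite divfK // gt_eqF.
have sn m : s ^+ m.+2 <= s ^+ 2.
  rewrite -addn2 exprD ler_piMl ?sqr_ge0 //.
  by rewrite exprn_ile1 // ltW.
have b m c : c * s ^+ m.+2 <= `|c| * s ^+ 2.
  apply: (le_trans (ler_norm _)); rewrite normrM ler_wpM2l //.
  by rewrite ger0_norm ?sn // exprn_ge0 // ltW.
have := h (- c1 * s).
have := b 0%N (c2 * c1 ^+ 2); have := b 1%N (- (c3 * c1 ^+ 3)).
have := b 2%N (c4 * c1 ^+ 4); rewrite normrN.
move=> h1 h2 h3 h4.
have : 0 <= s * (- c1 ^+ 2 + s * K) by rewrite /K; lra.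
rewrite pmulr_rge0 // => h5.
have : 0 < s * (c1 ^+ 2 + 1) by rewrite mulr_gt0 //; lra.
lra.
Qed.

Section Reduced.
Variables (R : rcfType) (n p : nat) (a : 'rV[R]_n) (w : 'rV[R]_p).

(** The matrix on the left is the gradient [D] of [h] at [Y].  The derivative of
    [h] in the direction [D] is [tr (D^T D)], which must vanish. *)
Lemma reduced_cost_critical (Y : 'M[R]_(n, p)) :
  (forall Z, reduced_cost a w Y <= reduced_cost a w Z) ->
  diag_mx a *m Y - Y *m diag_mx w + Y *m (Y^T *m Y) = 0.
Proof.
move=> minY; move DE: (X in X = 0) => D.
apply: mxtrace_gram_eq0.
(* G + t M + t^2 H is the Gram matrix of Y + t D.  The three matrices are
   abstracted so that distributivity does not expand them. *)
have [G GE] : {G | G = Y^T *m Y} by exists (Y^T *m Y).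
have [M ME] : {M | M = Y^T *m D + D^T *m Y} by exists (Y^T *m D + D^T *m Y).
have [H HE] : {H | H = D^T *m D} by exists (D^T *m D).
have DD : \tr (D^T *m D) = \tr (Y^T *m diag_mx a *m D)
    - \tr (Y^T *m D *m diag_mx w) + \tr (G *m (Y^T *m D)).
  rewrite -{2}DE mulmxDr mulmxBr linearD linearB /= -GE; congr (_ - _ + _).
  - by rewrite -mxtrace_tr !trmx_mul trmxK tr_diag_mx.
  - by rewrite -mxtrace_tr !trmx_mul trmxK tr_diag_mx -mulmxA mxtrace_mulC.
  - by rewrite GE -mxtrace_tr !trmx_mul !trmxK mulmxA.
have Ea : \tr (D^T *m diag_mx a *m Y) = \tr (Y^T *m diag_mx a *m D).
  by rewrite -mxtrace_tr !trmx_mul trmxK tr_diag_mx mulmxA.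
have Ew : \tr (D^T *m Y *m diag_mx w) = \tr (Y^T *m D *m diag_mx w).
  by rewrite -mxtrace_tr !trmx_mul trmxK tr_diag_mx mxtrace_mulC.
have Eg : \tr (G *m (D^T *m Y)) = \tr (G *m (Y^T *m D)).
  by rewrite GE -mxtrace_tr !trmx_mul !trmxK mxtrace_mulC.
apply: (@quartic_ge0_linear_eq0 _ _
  (1 / 2 * \tr (D^T *m diag_mx a *m D) - 1 / 2 * \tr (H *m diag_mx w)
   + 1 / 4 * (\tr (M *m M) + 2 * \tr (G *m H)))
  (1 / 2 * \tr (M *m H)) (1 / 4 * \tr (H *m H))) => t.
have := minY (Y + t *: D); rewrite /reduced_cost.
have -> : (Y + t *: D)^T = Y^T + t *: D^T by rewrite linearD linearZ.
have -> : (Y^T + t *: D^T) *m (Y + t *: D) = G + t *: M + t ^+ 2 *: H.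
  rewrite mulmxDl !mulmxDr -!scalemxAl -!scalemxAr scalerA.
  by rewrite -expr2 GE ME HE scalerDr !addrA.
have -> : \tr ((Y^T + t *: D^T) *m diag_mx a *m (Y + t *: D)) =
    \tr (Y^T *m diag_mx a *m Y) + 2 * t * \tr (Y^T *m diag_mx a *m D)
    + t ^+ 2 * \tr (D^T *m diag_mx a *m D).
  rewrite !mulmxDl !mulmxDr -!scalemxAl -!scalemxAr.
  by rewrite !linearD /= !linearZ /= Ea; ring.
rewrite -GE !mulmxDl !mulmxDr -!scalemxAl -!scalemxAr !linearD /= !linearZ /=.
rewrite [\tr (M *m G)]mxtrace_mulC [\tr (H *m G)]mxtrace_mulC.
rewrite [\tr (H *m M)]mxtrace_mulC.
have -> : \tr (G *m M) = 2 * \tr (G *m (Y^T *m D)).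
  by rewrite ME mulmxDr linearD /= Eg; ring.
have -> : \tr (M *m diag_mx w) = 2 * \tr (Y^T *m D *m diag_mx w).
  by rewrite ME mulmxDl linearD /= Ew; ring.
rewrite DD; lra.
Qed.

(** [Y^T] times the stationarity equation expresses [G W] as a symmetric matrix,
    so [G W = (G W)^T = W G], and a matrix commuting with a diagonal matrix with
    distinct entries is diagonal. *)
Lemma critical_gram_diag (Y : 'M[R]_(n, p)) :
  injective (w 0) ->
  diag_mx a *m Y - Y *m diag_mx w + Y *m (Y^T *m Y) = 0 ->
  forall j k, j != k -> (Y^T *m Y) j k = 0.
Proof.
move=> w_inj D0 j k jk; set G := Y^T *m Y.
have GW : G *m diag_mx w = Y^T *m diag_mx a *m Y + G *m G.
  apply/eqP; rewrite eq_sym -subr_eq0; apply/eqP.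
  by rewrite -(mulmx0 _ Y^T) -D0 mulmxDr mulmxBr !mulmxA addrAC.
have /matrixP/(_ j k) : G *m diag_mx w = diag_mx w *m G.
  have GT : G^T = G by rewrite trmx_mul trmxK.
  have GWT : (G *m diag_mx w)^T = G *m diag_mx w.
    by rewrite GW linearD /= !trmx_mul trmxK tr_diag_mx mulmxA.
  by rewrite -{1}GWT trmx_mul GT tr_diag_mx.
rewrite mul_mx_diag mul_diag_mx !mxE => /eqP.
rewrite -subr_eq0 mulrC -mulrBl mulf_eq0 subr_eq0 => /orP[/eqP/w_inj kj|/eqP ->//].
by rewrite kj eqxx in jk.
Qed.

(** Nonzero entries of one column all sit at indices with the same eigenvalue
    [a 0 i = w 0 j - G j j]: the column is an eigenvector of [diag_mx a]. *)
Lemma critical_entry (Y : 'M[R]_(n, p)) :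
  diag_mx a *m Y - Y *m diag_mx w + Y *m (Y^T *m Y) = 0 ->
  (forall j k, j != k -> (Y^T *m Y) j k = 0) ->
  forall i j, Y i j != 0 -> (Y^T *m Y) j j = w 0 j - a 0 i.
Proof.
move=> D0 Gd i j Yij; have [G GE] : {G | G = Y^T *m Y} by exists (Y^T *m Y).
move: D0 Gd; rewrite -GE => /matrixP/(_ i j) + Gd.
rewrite mul_mx_diag mul_diag_mx !mxE (bigD1 j) //= big1 => [|k kj]; last first.
  by rewrite Gd ?mulr0.
by rewrite addr0 => h; apply: (mulfI Yij); lra.
Qed.

(** * Matrices with orthogonal columns *)

Definition column_cost (Y : 'M[R]_(n, p)) (j : 'I_p) : R :=
  1 / 2 * (\sum_i (a 0 i - w 0 j) * Y i j ^+ 2) + 1 / 4 * (Y^T *m Y) j j ^+ 2.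

Lemma reduced_cost_columns (Y : 'M[R]_(n, p)) :
  (forall j k, j != k -> (Y^T *m Y) j k = 0) ->
  reduced_cost a w Y = \sum_j column_cost Y j.
Proof.
move=> Gd; rewrite /reduced_cost /column_cost big_split /= -!mulr_sumr.
rewrite -mulrBr; congr (_ * _ + _ * _).
  rewrite -sumrB; apply: eq_bigr => j _.
  rewrite -mulmxA mul_diag_mx mul_mx_diag !mxE mulr_suml -sumrB.
  by apply: eq_bigr => i _; rewrite !mxE; ring.
apply: eq_bigr => j _; rewrite mxE (bigD1 j) //= big1 ?addr0 ?expr2 // => k kj.
by rewrite Gd ?mul0r // eq_sym.
Qed.

(** At a stationary point the quadratic part of the column cost is
    [- 1/2 G_jj ^ 2], so that larger columns are cheaper. *)
Lemma critical_column_cost (Y : 'M[R]_(n, p)) j :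
  (forall i, Y i j != 0 -> (Y^T *m Y) j j = w 0 j - a 0 i) ->
  column_cost Y j = - (1 / 4) * (Y^T *m Y) j j ^+ 2.
Proof.
move=> crit; rewrite /column_cost.
have -> : \sum_i (a 0 i - w 0 j) * Y i j ^+ 2 =
    - (Y^T *m Y) j j * (Y^T *m Y) j j.
  rewrite {2}gramE mulr_sumr; apply: eq_bigr => i _.
  have [->|/crit ->] := eqVneq (Y i j) 0; ring.
by field.
Qed.

(** The competitor against [Y]: column [j] becomes [alpha e_i0] and column [k]
    becomes [beta] times the old column [j].  For [k = j] only column [j] is
    replaced, since the test [l == j] comes first. *)
Definition replace_columns (Y : 'M[R]_(n, p)) (i0 : 'I_n) (j k : 'I_p)
    (alpha beta : R) : 'M[R]_(n, p) :=
  \matrix_(i, l) if l == j then alpha * (i == i0)%:R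
                 else if l == k then beta * Y i j else Y i l.

(** The hypotheses on [Y] say that row [i0] can be nonzero only in column [k], which
    is overwritten; hence [e_i0] is orthogonal to all the other new columns, and
    the cost of the competitor splits into column costs. *)
Lemma replace_columns_cost (Y : 'M[R]_(n, p)) i0 j k alpha beta :
  (forall l m, l != m -> (Y^T *m Y) l m = 0) ->
  (forall l, l != k \/ l = j -> Y i0 l = 0) ->
  reduced_cost a w (replace_columns Y i0 j k alpha beta) =
  \sum_l if l == j
         then 1 / 2 * ((a 0 i0 - w 0 j) * alpha ^+ 2) + 1 / 4 * alpha ^+ 4
         else if l == k
         then 1 / 2 * (beta ^+ 2 * \sum_i (a 0 i - w 0 k) * Y i j ^+ 2)
              + 1 / 4 * (beta ^+ 2 * (Y^T *m Y) j j) ^+ 2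
         else column_cost Y l.
Proof.
move=> Gd Y0; set Z := replace_columns _ _ _ _ _ _.
have delta_sum (F : 'I_n -> R) : \sum_i (i == i0)%:R * F i = F i0.
  rewrite (bigD1 i0) //= eqxx mul1r big1 ?addr0 // => i /negPf ->.
  by rewrite mul0r.
have Zj m : m != j -> (Z^T *m Z) j m = 0.
  move=> mj; rewrite gramE.
  have -> : \sum_i Z i j * Z i m = alpha * Z i0 m.
    rewrite -(delta_sum (Z^~ m)) mulr_sumr; apply: eq_bigr => i _.
    by rewrite {1}mxE eqxx mulrA.
  rewrite mxE (negPf mj); case: (eqVneq m k) => mk.
    by rewrite Y0 ?mulr0 //; right.
  by rewrite Y0 ?mulr0 //; left.
have Zk m : m != j -> k != j -> m != k -> (Z^T *m Z) k m = 0.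
  move=> mj kj mk; rewrite gramE.
  have -> : \sum_i Z i k * Z i m = beta * (Y^T *m Y) j m.
    rewrite gramE mulr_sumr; apply: eq_bigr => i _.
    by rewrite !mxE (negPf kj) (negPf mj) (negPf mk) eqxx mulrA.
  by rewrite Gd ?mulr0 // eq_sym.
have Gsym l m : (Z^T *m Z) l m = (Z^T *m Z) m l.
  by rewrite !gramE; apply: eq_bigr => i _; rewrite mulrC.
have Zd l m : l != m -> (Z^T *m Z) l m = 0.
  move=> lm; have [lj|lj] := eqVneq l j.
    by rewrite lj Zj // eq_sym -lj.
  have [mj|mj] := eqVneq m j; first by rewrite mj Gsym Zj.
  have [lk|lk] := eqVneq l k.
    by subst l; rewrite Zk // eq_sym.
  have [mk|mk] := eqVneq m k; first by subst m; rewrite Gsym Zk.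
  rewrite -(Gd l m lm) !gramE; apply: eq_bigr => i _.
  by rewrite !mxE !ifN.
rewrite reduced_cost_columns //; apply: eq_bigr => l _.
rewrite /column_cost gramE.
case: (eqVneq l j) => lj.
  subst l.
  have e (c : 'I_n -> R) : \sum_i c i * Z i j ^+ 2 = c i0 * alpha ^+ 2.
    rewrite -(delta_sum (fun i => c i * alpha ^+ 2)); apply: eq_bigr => i _.
    by rewrite mxE eqxx; case: (i == i0); rewrite /=; ring.
  rewrite e; under eq_bigr do rewrite -expr2 -[_ ^+ 2]mul1r.
  by rewrite e; ring.
case: (eqVneq l k) => lk.
  subst l; rewrite !mulr_sumr gramE mulr_sumr.
  congr (_ + 1 / 4 * _ ^+ 2); apply: eq_bigr => i _.
    by rewrite mxE (negPf lj) eqxx; ring.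
  by rewrite mxE (negPf lj) eqxx; ring.
rewrite gramE; congr (_ * _ + _ * _ ^+ 2); apply: eq_bigr => i _;
  by rewrite mxE (negPf lj) (negPf lk).
Qed.

(** The rearrangement behind the exchange of columns [j] and [k].  Here [A] is
    [w_j - a_j], [x] and [z] are the squared norms of the old columns, and
    [u = b ^ 2 x] is the squared norm of the new column [k].  The unconstrained
    best value is [u = x + z - A], for which the gain is [2 (A - x) (A - z)]; when
    it is not positive, the new column [k] is taken to be zero. *)
Lemma exists_swap_gain (A x z : R) : 0 <= x < A -> 0 < z < A ->
  exists b : R, x ^+ 2 + z ^+ 2
    < A ^+ 2 + 2 * (x + z - A) * (b ^+ 2 * x) - (b ^+ 2 * x) ^+ 2.
Proof.
move=> /andP[x0 xA] /andP[z0 zA].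
have [Dneg|Dpos] := leP (x + z) A.
  exists 0; rewrite expr0n /= mul0r mulr0 addr0 expr0n /= subr0.
  have : 0 <= (A - (x + z)) * (A + (x + z)) by rewrite mulr_ge0; lra.
  have [->|xn0] := eqVneq x 0.
    have : 0 < (A - z) * (A + z) by rewrite mulr_gt0; lra.
    lra.
  have : 0 < x * z by rewrite mulr_gt0 // lt_def xn0.
  lra.
have xp : 0 < x by lra.
exists (Num.sqrt ((x + z - A) / x)).
rewrite sqr_sqrtr; last by rewrite divr_ge0; lra.
rewrite divfK ?gt_eqF //.
have : 0 < (A - x) * (A - z) by rewrite mulr_gt0; lra.
lra.
Qed.

(** * Structure of the minimizers *)

Section Minimizer.
Variables (hpn : (p <= n)%N) (Y : 'M[R]_(n, p)).
Let lead := widen_ord hpn.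
Hypothesis a_lt : forall (j : 'I_p) (i : 'I_n), (j < i)%N -> a 0 (lead j) < a 0 i.
Hypothesis w_gt : forall j k : 'I_p, (j < k)%N -> w 0 k < w 0 j.
Hypothesis gap : forall j, a 0 (lead j) < w 0 j.
Hypothesis minY : forall Z, reduced_cost a w Y <= reduced_cost a w Z.

Lemma lead_simple (j : 'I_p) (i : 'I_n) : a 0 i = a 0 (lead j) -> i = lead j.
Proof.
move=> aij; apply/val_inj => /=; case: (ltngtP i j) => // ij.
  have ip := ltn_trans ij (ltn_ord j).
  have := @a_lt (Ordinal ip) (lead j) ij; rewrite -aij.
  have -> : lead (Ordinal ip) = i by apply/val_inj.
  by rewrite ltxx.
by have := a_lt ij; rewrite aij ltxx.
Qed.

Lemma weight_inj : injective (w 0).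
Proof.
move=> j k wjk; apply/val_inj => /=; case: (ltngtP j k) => // jk.
  by have := w_gt jk; rewrite wjk ltxx.
by have := w_gt jk; rewrite wjk ltxx.
Qed.

Lemma minimizer_gram j k : j != k -> (Y^T *m Y) j k = 0.
Proof.
exact: (critical_gram_diag weight_inj (reduced_cost_critical minY)).
Qed.

Lemma minimizer_entry i j : Y i j != 0 -> (Y^T *m Y) j j = w 0 j - a 0 i.
Proof.
exact: (critical_entry (reduced_cost_critical minY) minimizer_gram).
Qed.

(** A column is an eigenvector and [a_j] is a simple eigenvalue, so a column that
    meets [e_j] is a multiple of it. *)
Lemma minimizer_column_support i j k :
  Y (lead j) k != 0 -> Y i k != 0 -> i = lead j.
Proof.
move=> /minimizer_entry Gk /minimizer_entry; rewrite Gk => aE.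
by apply: lead_simple; lra.
Qed.

(** Column [j] is a multiple of the basis vector at [lead i], to which the other
    columns are orthogonal. *)
Lemma minimizer_row_support i j k :
  Y (lead i) j != 0 -> k != j -> Y (lead i) k = 0.
Proof.
move=> Yij kj; have := minimizer_gram kj.
rewrite gramE (bigD1 (lead i)) //= big1 => [|l li].
  by rewrite addr0 => /eqP; rewrite mulf_eq0 (negPf Yij) orbF => /eqP.
have [->|/(minimizer_column_support Yij) lE] := eqVneq (Y l j) 0.
  by rewrite mulr0.
by rewrite lE eqxx in li.
Qed.

(** By induction, the columns before [j] occupy the first directions, so column [j]
    lives in the directions from [j] on; if it misses [e_j], the strict gap above
    the simple eigenvalue [a_j] leaves room for a cheaper competitor. *)
Lemma minimizer_diag_neq0 j : Y (lead j) j != 0.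
Proof.
have [m] := ubnP (val j); elim: m j => // m IH j; rewrite ltnS => jm.
apply/negP => /eqP Yjj0.
have prev i : Y i j != 0 -> (j <= i)%N.
  move=> Yij; rewrite leqNgt; apply/negP => ij.
  pose l := Ordinal (ltn_trans ij (ltn_ord j)).
  have li : lead l = i by apply/val_inj.
  have Yll := IH l (leq_trans ij jm).
  have jl : j != l by rewrite -val_eqE /= neq_ltn ij orbT.
  by move: Yij; rewrite -li (minimizer_row_support Yll jl) eqxx.
pose A := w 0 j - a 0 (lead j); set x := (Y^T *m Y) j j.
have xA : 0 <= x < A.
  rewrite gram_ge0 /=; have [i Yij|noY] := pickP (fun i => Y i j != 0).
    rewrite /x (minimizer_entry Yij) /A ltrD2l ltrN2 a_lt //.
    rewrite ltn_neqAle prev // andbT; apply/eqP => ji.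
    have ij : i = lead j by apply/val_inj.
    by rewrite ij Yjj0 eqxx in Yij.
  rewrite /x gramE big1 ?subr_gt0 // => i _.
  by have /negbFE/eqP -> := noY i; rewrite mul0r.
have A0 : 0 < A by case/andP: xA => /le_lt_trans h /h.
have sA : Num.sqrt A ^+ 2 = A by rewrite sqr_sqrtr // ltW.
have sA4 : Num.sqrt A ^+ 4 = A ^+ 2 by rewrite (exprM _ 2 2) sA.
have costY l : column_cost Y l = - (1 / 4) * (Y^T *m Y) l l ^+ 2.
  by apply: critical_column_cost => i; exact: minimizer_entry.
(* Either some column k uses the direction e_j and has to be exchanged with
   column j, or e_j is free and column j alone is replaced. *)
have [k Yjk|noY] := pickP (fun k => Y (lead j) k != 0); last first.
  have := minY (replace_columns Y (lead j) j j (Num.sqrt A) 0).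
  rewrite (replace_columns_cost _ _ minimizer_gram); last first.
    by move=> l _; have /negbFE/eqP := noY l.
  rewrite (reduced_cost_columns minimizer_gram) (bigD1 j) //=.
  rewrite [in leRHS](bigD1 j) //= eqxx.
  under [X in _ <= _ + X]eq_bigr => l lj do rewrite (negPf lj).
  rewrite lerD2r costY -/x sA sA4 leNgt => /negP; apply.
  have : x ^+ 2 < A ^+ 2 by rewrite ltr_pXn2r ?nnegrE //; lra.
  rewrite /A; lra.
have kj : k != j by apply/eqP => kE; rewrite kE Yjj0 eqxx in Yjk.
(* A column before j is already known to point in another direction. *)
have jk : (j < k)%N.
  rewrite ltn_neqAle eq_sym val_eqE kj leqNgt /=; apply/negP => kj'.
  have := minimizer_column_support Yjk (IH k (leq_trans kj' jm)).
  by move/(congr1 val) => /= kE; rewrite kE ltnn in kj'.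
pose z := (Y^T *m Y) k k.
have zE : z = w 0 k - a 0 (lead j) by exact: minimizer_entry.
have zA : 0 < z < A.
  by rewrite (gram_gt0 Yjk) zE /A ltrD2r w_gt.
have [b] := exists_swap_gain xA zA.
have := minY (replace_columns Y (lead j) j k (Num.sqrt A) b).
rewrite (replace_columns_cost _ _ minimizer_gram); last first.
  by move=> l [lk|->//]; exact: minimizer_row_support Yjk lk.
rewrite (reduced_cost_columns minimizer_gram) (bigD1 j) //= (bigD1 k) //=.
rewrite [in leRHS](bigD1 j) //= [in leRHS](bigD1 k) //= !eqxx (negPf kj).
under [X in _ <= _ + (_ + X)]eq_bigr => l /andP[lj lk]
  do rewrite (negPf lj) (negPf lk).
rewrite !costY -/x -/z sA sA4 !addrA lerD2r.
have -> : \sum_i (a 0 i - w 0 k) * Y i j ^+ 2 = (w 0 j - x - w 0 k) * x.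
  rewrite {2}/x gramE mulr_sumr; apply: eq_bigr => i _.
  have [->|/minimizer_entry Gj] := eqVneq (Y i j) 0; first by ring.
  by rewrite /x Gj; ring.
have -> : w 0 j - x - w 0 k = A - x - z by rewrite zE /A; ring.
have -> : a 0 (lead j) - w 0 j = - A by rewrite /A; ring.
lra.
Qed.

Lemma minimizer_off_diag i j : i != lead j -> Y i j = 0.
Proof.
move=> ij; apply/eqP/negPn/negP => Yij.
by rewrite (minimizer_column_support (minimizer_diag_neq0 j) Yij) eqxx in ij.
Qed.

Lemma minimizer_diag_sqr j : Y (lead j) j ^+ 2 = w 0 j - a 0 (lead j).
Proof.
rewrite -(minimizer_entry (minimizer_diag_neq0 j)) gramE (bigD1 (lead j)) //=.
by rewrite big1 ?addr0 // => i ij; rewrite minimizer_off_diag ?mul0r.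
Qed.
End Minimizer.
End Reduced.

(* Indices are 0-based: lambda_i of the text is lam 0 i with i shifted by one,
   so the chain lambda_1 < ... < lambda_p < lambda_{p+1} says that lam strictly
   increases from any position i < p to any later one. *)
Theorem theorem2p2 (R : realType) (n p : nat) (hp : (1 <= p)%N)
    (hpn : (p < n)%N)
    (A V : 'M[R]_n) (lam : 'rV[R]_n)
    (hA : A^T = A)
    (hV : orthogonal_mx V)
    (hAV : A = V *m diag_mx lam *m V^T)
    (hlam_lt : forall i j : 'I_n, (i < j)%N -> (i < p)%N -> lam 0 i < lam 0 j)
    (hlam_le : forall i j : 'I_n, (i <= j)%N -> lam 0 i <= lam 0 j)
    (mu : R) (hmu : 0 < mu)
    (w : 'rV[R]_p)
    (hw_lt : forall i j : 'I_p, (i < j)%N -> w 0 j < w 0 i)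
    (hw_last : forall i : 'I_p, i.+1 = p ->
       lam 0 (widen_ord (ltnW hpn) i) / mu < w 0 i)
    (X : 'M[R]_(n, p))
    (hX : global_minimizer (penalty_fun A mu (diag_mx w)) X) :
  exists sgn : 'I_p -> bool,
    X = leading_cols (ltnW hpn) V *m
        diag_mx (\row_(i < p) ((-1) ^+ sgn i *
          Num.sqrt (w 0 i - lam 0 (widen_ord (ltnW hpn) i) / mu))).
Proof.
set lead := widen_ord (ltnW hpn).
pose a := mu^-1 *: lam; pose Y := V^T *m X.
have aE i : a 0 i = lam 0 i / mu by rewrite mxE mulrC.
have XE : X = V *m Y by rewrite mulmxA (mulmx1C hV) mul1mx.
have mu0 : mu != 0 by rewrite gt_eqF.
have minY Z : reduced_cost a w Y <= reduced_cost a w Z.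
  have := hX (V *m Z); rewrite XE hAV !penalty_reduced // lerD2r.
  by rewrite ler_pM2l.
have a_lt (j : 'I_p) (i : 'I_n) : (j < i)%N -> a 0 (lead j) < a 0 i.
  by move=> ji; rewrite !aE ltr_pM2r ?invr_gt0 // hlam_lt /=.
(* The gap at the last index propagates: a increases and w decreases. *)
have gap j : a 0 (lead j) < w 0 j.
  have pE : (p.-1 < p)%N by rewrite prednK.
  pose q := Ordinal pE.
  have := hw_last q (prednK hp); rewrite -/lead -aE => aq.
  have [->//|jq] := eqVneq j q.
  have {}jq : (j < q)%N.
    by rewrite ltn_neqAle val_eqE jq /= -ltnS prednK.
  by apply: lt_trans (hw_lt _ _ jq); apply: lt_trans aq; exact: a_lt.
have diagY := minimizer_diag_sqr a_lt hw_lt gap minY.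
have offY := minimizer_off_diag a_lt hw_lt gap minY.
clearbody Y; exists (fun j => Y (lead j) j < 0); apply/matrixP => i j.
rewrite {1}XE mul_mx_diag !mxE (bigD1 (lead j)) //= big1 => [|l lj]; last first.
  by rewrite offY ?mulr0.
by rewrite addr0 -aE -diagY sqrtr_sqr -realEsign // num_real.
Qed.
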